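(* Let $\mathcal{A}$ be a $\sigma$-structure (function symbols possibly interpreted by partial functions), $I$ a set and $\mathcal{U}$ an ultrafilter over $I$. Every element of $A^I/\mathcal{U}$ has a representative in $\mathrm{rep}(\mathcal{A}^I)$ if and only if $\mathcal{U}$ is $\kappa^+$-complete, where $\kappa=|\overline{\mathrm{supp}}(\mathcal{A})|$.
   Context: The support $\mathrm{supp}(\mathcal{A})$ is the set of $a\in A$ such that for every function symbol $F$ of $\sigma$ (of arity $n$), every position $1\le p\le n$ and all $x_1,\dots,x_n\in A$, $F^{\mathcal{A}}$ is defined at the tuple obtained from $(x_1,\dots,x_n)$ by placing $a$ in position $p$. The anti-support is $\overline{\mathrm{supp}}(\mathcal{A})=A\setminus\mathrm{supp}(\mathcal{A})$. For $a\in A$, $\overline{a}$ is the constant function $I\to\{a\}$. $\mathrm{rep}(\mathcal{A}^I)=\{\overline{a}\mid a\in\overline{\mathrm{supp}}(\mathcal{A})\}\cup\{f\in A^I\mid f(j)\in\mathrm{supp}(\mathcal{A})\text{ for all }j\in I\}$. Elements of $A^I/\mathcal{U}$ are equivalence classes of functions $I\to A$ modulo agreement on a set in $\mathcal{U}$. An ultrafilter is $\mu$-complete if it is closed under intersections of fewer than $\mu$ of its members. *)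

(* Defs.v *)
From HB Require Import structures.
From mathcomp Require Import all_boot.
From mathcomp Require Import boolp classical_sets functions cardinality filter.

Set Implicit Arguments.
Unset Strict Implicit.
Unset Printing Implicit Defensive.

Local Open Scope classical_set_scope.
Local Open Scope card_scope.

Record signature := Signature {
  fun_sym : Type ;
  fun_arity : fun_sym -> nat ;
  rel_sym : Type ;
  rel_arity : rel_sym -> nat }.

(* The value None of fun_interp means that the function is undefined there;
   constants are function symbols of arity 0. *)
Record structure (sigma : signature) := Structure {
  carrier :> Type ;
  fun_interp : forall F : fun_sym sigma,
    ('I_(fun_arity F) -> carrier) -> option carrier ;
  rel_interp : forall R : rel_sym sigma,
    ('I_(rel_arity R) -> carrier) -> Prop }.

Section Support.
Variables (sigma : signature) (A : structure sigma).

Definition supp : set A :=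
  [set a | forall (F : fun_sym sigma) (p : 'I_(fun_arity F))
             (x : 'I_(fun_arity F) -> A),
             isSome (fun_interp [eta x with p |-> a])].

Definition antisupp : set A := ~` supp.

Definition rep (I : Type) : set (I -> A) :=
  [set cst a | a in antisupp] `|` [set f | forall j, supp (f j)].

End Support.
Arguments supp {sigma} A.
Arguments antisupp {sigma} A.
Arguments rep {sigma} A I.

Section Ultrapower.
Variables (I T : Type) (U : set_system I).

Definition ueq (f g : I -> T) : Prop := U [set i | f i = g i].

(* T^I/U, as the set of the equivalence classes of ueq. *)
Definition ultrapower : set (set (I -> T)) := range ueq.

End Ultrapower.
Arguments ultrapower {I} T U.

Definition card_lt (T V : Type) (A : set T) (B : set V) : Prop :=
  A #<= B /\ ~ (B #<= A).

(* The cardinal mu is given as the cardinal of a set M. The family G may be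
   empty, its intersection is then the whole of I. *)
Definition complete_filter (I V : Type) (M : set V) (U : set_system I) : Prop :=
  forall G : set (set I), G `<=` U -> card_lt G M -> U (\bigcap_(X in G) X).

Definition is_succ_card (T V : Type) (K : set T) (M : set V) : Prop :=
  card_lt K M /\ forall (W : Type) (N : set W), card_lt K N -> M #<= N.

(* A set of cardinal |K|^+. When K is infinite, this is the usual successor;
   when |K| = n is finite, it has n + 1 elements. By Cantor's theorem |K|^+ is
   at most the cardinal of the power set of K, so such a set exists among the
   sets of subsets of T: see succ_cardP below. *)
Definition succ_card (T : Type) (K : set T) : set (set T) :=
  xget set0 [set M | is_succ_card K M].

Lemma least_card (P : Type) (p0 : P) (Fm : set (set P)) : Fm !=set0 ->
  exists2 M, Fm M & forall N, Fm N -> M #<= N.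
Proof.
move=> [X0 FX0].
pose good (D : set (set P -> P)) :=
  (forall f X, D f -> Fm X -> X (f X)) /\
  (forall f g X, D f -> D g -> Fm X -> f X = g X -> f = g).
have [|D [[Din Dinj] Dmax]] := @Zorn_bigcup _ [set D | good D].
  move=> G Gg tot; split=> [f X [D GD Df] FX|f g X [D GD Df] [E GE Eg] FX].
    by have [/(_ _ _ Df FX)] := Gg _ GD.
  have [DE|ED] := tot _ _ GD GE.
    by have [_ /(_ f g X (DE _ Df) Eg FX)] := Gg _ GE.
  by have [_ /(_ f g X Df (ED _ Eg) FX)] := Gg _ GD.
have [[X FX Xsurj]|noX] :=
    pselect (exists2 X, Fm X & X `<=` [set f X | f in D]).
  exists X => // N FN.
  apply: (card_le_trans (subset_card_le Xsurj)).
  apply: (card_le_trans (card_image_le _ _)).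
  have injN : {in D &, injective (fun f => f N)}.
    by move=> f g /set_mem Df /set_mem Dg; exact: Dinj.
  have /card_eqPle[_ le1] := inj_card_eq injN.
  apply: (card_le_trans le1); apply: subset_card_le => _ [f Df <-] /=.
  exact: (Din f N).
have hP X : exists x, Fm X -> X x /\ ~ [set f X | f in D] x.
  have [FX|?] := pselect (Fm X); last by exists p0.
  have /existsNP[x /not_implyP[Xx nx]] : ~ X `<=` [set f X | f in D].
    by move=> h; apply: noX; exists X.
  by exists x.
pose h X := projT1 (cid (hP X)).
have hX X : Fm X -> X (h X) /\ ~ [set f X | f in D] (h X).
  by rewrite /h; case: cid.
have hneq f X : D f -> Fm X -> f X <> h X.
  by move=> Df FX e; case: (hX X FX) => _; apply; exists f.
exfalso; apply: (Dmax (h |` D)).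
  split=> [f Df|/(_ h)]; first by right.
  by move=> /(_ (or_introl erefl)) /hneq /(_ FX0).
split=> [f X [->|Df] FX|f g X [->|Df] [->|Dg] FX //].
- by case: (hX X FX).
- exact: (Din f X).
- by move=> /esym /(hneq _ _ Dg FX).
- by move=> /(hneq _ _ Df FX).
- exact: Dinj Df Dg FX.
Qed.

Lemma card_le_total (T V : Type) (A : set T) (B : set V) :
  A #<= B \/ B #<= A.
Proof.
have [->|/set0P[a Aa]] := eqVneq A set0; first by left; exact: card_ge0.
have eA : (@inl T V) @` A #= A by apply: inj_card_eq => x y _ _ [].
have eB : (@inr T V) @` B #= B by apply: inj_card_eq => x y _ _ [].
have [|M FM Mle] := @least_card (T + V)%type (inl a) [set inl @` A; inr @` B].
  by exists (inl @` A); left.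
case: FM Mle => ->.
  by move=> /(_ _ (or_intror erefl)); rewrite (card_le_eql eA) (card_le_eqr eB); left.
by move=> /(_ _ (or_introl erefl)); rewrite (card_le_eql eB) (card_le_eqr eA); right.
Qed.

Lemma card_lt_powerset (T : Type) (K : set T) : card_lt K [set X | X `<=` K].
Proof.
split.
  have /card_eqPle[_ le1] : (fun x : T => [set x]) @` K #= K.
    by apply: inj_card_eq => x y _ _ e; have : [set x] y by rewrite e.
  apply: (card_le_trans le1); apply: subset_card_le => _ [x Kx <-] _ ->; exact: Kx.
move=> /pcard_surjP[g gs].
have [x Kx gx] := gs [set y | K y /\ ~ g y y] (fun y => @proj1 _ _).
have ngx : ~ g x x by move=> gxx; move: (gxx); rewrite gx => -[_]; exact.
by apply: (ngx); rewrite gx.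
Qed.

Lemma succ_cardP (T : Type) (K : set T) : is_succ_card K (succ_card K).
Proof.
apply: (@xgetPex _ set0 [set M | is_succ_card K M]).
have [|M KM Mle] := @least_card (set T) set0 [set M | card_lt K M].
  by exists [set X | X `<=` K]; exact: card_lt_powerset.
exists M; split=> // W N KN.
have [leN|leN] := card_le_total N [set: set T]; last first.
  exact: card_le_trans (card_leT M) leN.
have /card_subP[C CN _] := leN.
rewrite -(card_le_eqr CN); apply: Mle.
by case: KN; split; rewrite ?(card_le_eqr CN) ?(card_le_eql CN).
Qed.

(* Main.v *)
Require Import Defs.
From mathcomp Require Import all_boot.
From mathcomp Require Import boolp classical_sets functions cardinality filter.

(** Write [S] for the anti-support. If [U] is closed under intersections of at
    most [|S|] members and [f] is not constant modulo [U] with a value in [S],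
    then the complements of the fibres of [f] over [S] all lie in [U], and so
    does their intersection, on which [f] takes values in the support.
    Conversely, if [G] is a subfamily of [U] indexed by [S] whose intersection
    is not in [U], then send almost every [i] to an index in [S] of a member of
    [G] that misses [i]: this function has values in [S], but it is not constant
    modulo [U], as a member of [G] would then be disjoint from a set of [U]. *)

Local Open Scope classical_set_scope.
Local Open Scope card_scope.

(** Makes [complete_filter (succ_card K) U] a condition on the families that are images of [K]. *)
Lemma card_lt_succ (T V : Type) (K : set T) (G : set V) :
  card_lt G (succ_card K) <-> G #<= K.
Proof.
have [[leKM nleMK] leM] := succ_cardP K.
split=> [[_ nleMG]|leGK].
  have [//|leKG] := card_le_total G K.
  apply: contrapT => nleGK; apply: nleMG; exact: leM.
split; first exact: card_le_trans leGK leKM.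
by move=> leMG; apply: nleMK; exact: card_le_trans leMG leGK.
Qed.

Lemma ultra_setC (I : Type) (U : set_system I) (UU : UltraFilter U)
  (X : set I) : ~ U X -> U (~` X).
Proof. by have [|] := in_ultra_setVsetC X UU. Qed.

Lemma complete_constant_or_avoids (I T : Type) (U : set_system I)
    (UU : UltraFilter U) (S : set T) (f : I -> T) :
  complete_filter (succ_card S) U ->
  (exists2 a, S a & U [set i | f i = a]) \/ U [set i | ~ S (f i)].
Proof.
move=> compU.
have [|nconst] := pselect (exists2 a, S a & U [set i | f i = a]); first by left.
right; pose G := [set ~` [set i | f i = a] | a in S].
have GU : G `<=` U.
  move=> _ [a Sa <-]; apply: ultra_setC => Ufa.
  by apply: nconst; exists a.
have : U (\bigcap_(X in G) X).
  by apply: compU => //; apply/card_lt_succ; exact: card_image_le.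
apply: filterS => i fi Sfi.
by have := fi _ (ex_intro2 _ _ _ Sfi erefl); apply.
Qed.

Lemma constant_or_avoids_complete (I T : Type) (U : set_system I)
    (UU : UltraFilter U) (S : set T) :
  (forall f : I -> T,
    (exists2 a, S a & U [set i | f i = a]) \/ U [set i | ~ S (f i)]) ->
  complete_filter (succ_card S) U.
Proof.
move=> constU G GU /card_lt_succ /pcard_surjP[g gs].
(* A nonempty [G] forces [S] to be nonempty, which supplies the default value [a0] of [f]. *)
have [->|/set0P[X0 GX0]] := eqVneq G set0.
  by rewrite bigcap_set0; exact: filterT.
apply: contrapT => /ultra_setC UN.
have [a0 Sa0 _] := gs _ GX0.
have pick i : exists a,
    S a /\ ((~` \bigcap_(X in G) X) i -> G (g a) /\ ~ g a i).
  have [Ni|nNi] := pselect ((~` \bigcap_(X in G) X) i); last by exists a0.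
  have /existsNP[X /not_implyP[GX nXi]] := Ni.
  have [a Sa ga] := gs _ GX.
  by exists a; rewrite ga.
have [f fP] := choice pick.
have [[a Sa Ufa]|UnS] := constU f; last first.
  apply: (@filter_not_empty _ U); apply: filterS UnS => i; apply.
  by have [] := fP i.
have UNa : U (~` (\bigcap_(X in G) X) `&` [set i | f i = a]) by exact: filterI.
have [i [Ni fia]] := filter_ex UNa.
have Uga : U (g a) by have [_ /(_ Ni)] := fP i; rewrite fia => -[/GU].
(* Such a [j] contradicts the choice of [f]: [g (f j)] misses [j], yet [f j = a] and [j] lies in
   [g a]. *)
have [j [[Nj fja] gaj]] := filter_ex (filterI UNa Uga).
by have [_ /(_ Nj)] := fP j; rewrite fja => -[].
Qed.

(** Reduces the theorem to a dichotomy that sees the structure only through its anti-support. *)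
Lemma ueq_rep (sigma : signature) (A : structure sigma) (I : Type)
    (U : set_system I) (UU : UltraFilter U) (f : I -> A) :
  (exists2 g, rep A I g & ueq U f g) <->
  (exists2 a, antisupp A a & U [set i | f i = a]) \/
  U [set i | ~ antisupp A (f i)].
Proof.
split=> [[g [[a Sa <-]|gs] fg]|[[a Sa Ufa]|Us]].
- by left; exists a.
- by right; apply: filterS fg => i /= ->; apply; exact: gs.
- by exists (cst a) => //; left; exists a.
have {}Us : U [set i | supp A (f i)] by apply: filterS Us => i /contrapT.
(* Members of [U] are nonempty, so the support contains some [f i0], which can replace the values of
   [f] outside the support. *)
have [i0 si0] := filter_ex Us.
exists (fun i => if pselect (supp A (f i)) then f i else f i0).
  by right=> j /=; case: pselect.
by apply: filterS Us => i /= si; case: pselect.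
Qed.

Theorem theorem4p28 (sigma : signature) (A : structure sigma) (I : Type)
    (U : set_system I) (UU : UltraFilter U) :
  (forall c : set (I -> A), ultrapower A U c ->
     exists2 f : I -> A, rep A I f & c f)
  <-> complete_filter (succ_card (antisupp A)) U.
Proof.
split=> [repU|compU _ [f _ <-]].
  apply: constant_or_avoids_complete => f.
  by apply/ueq_rep; apply: repU; exists f.
by apply/ueq_rep; exact: complete_constant_or_avoids.
Qed.
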